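(* Let $(N,L)$ be a pair of finite dimensional Lie superalgebras over $\mathbb{F}$ such that $N$ has a complement in $L$ and $\dim N=(m|n)$. Then $$\dim \mathcal{M}(N,L)\leq \frac{1}{2}\big((m+n)^2+(n-m)\big)+\dim N\,\dim(L/N)-\dim[N,L].$$
   Context: Let $\mathbb{F}$ be an algebraically closed field of characteristic $\neq 2,3$; all superspaces and superalgebras are over $\mathbb{F}$. A Lie superalgebra is a $\mathbb{Z}_2$-graded vector space $L=L_0\oplus L_1$ with a bilinear bracket such that $[L_a,L_b]\subseteq L_{a+b}$, and for homogeneous $x,y,z$ (with $|x|$ denoting the degree of $x$): $[x,y]=-(-1)^{|x||y|}[y,x]$ and $(-1)^{|x||z|}[x,[y,z]]+(-1)^{|y||x|}[y,[z,x]]+(-1)^{|z||y|}[z,[x,y]]=0$. A graded ideal of $L$ is a $\mathbb{Z}_2$-graded subspace $I$ with $[I,L]\subseteq I$. A pair of Lie superalgebras $(N,L)$ is a Lie superalgebra $L$ together with a graded ideal $N$ of $L$. A complement of $N$ in $L$ is a sub-superalgebra $K$ of $L$ with $L=N\oplus K$ as superspaces. For graded subspaces $A,B$, $[A,B]$ denotes the linear span of all brackets $[a,b]$, $a\in A$, $b\in B$. Schur multiplier: let $0\to R\to F\to L\to 0$ be a free presentation of $L$ (i.e. $F$ is a free Lie superalgebra, and $R$ is the kernel of a surjective homomorphism $F\to L$ of Lie superalgebras, homomorphisms being linear maps preserving degree and bracket), and let $S$ be the graded ideal of $F$ with $N\cong S/R$ (the preimage of $N$). Then $\mathcal{M}(N,L)=\dfrac{R\cap[S,F]}{[R,F]}$.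 This is an abelian Lie superalgebra, independent (up to isomorphism) of the choice of free presentation. Writing $\dim V=(m|n)$ for a superspace $V=V_0\oplus V_1$ means $\dim V_0=m$ and $\dim V_1=n$. In numerical formulas and inequalities, $\dim V$ denotes the total dimension $\dim V_0+\dim V_1$ (so $\dim N$ in the bound is $m+n$). *)

(* Defs.v *)
From HB Require Import structures.
From mathcomp Require Import all_boot all_order all_algebra.
From mathcomp Require Import boolp classical_sets.

Set Implicit Arguments.
Unset Strict Implicit.
Unset Printing Implicit Defensive.

Import GRing.Theory.

Local Open Scope classical_set_scope.
Local Open Scope ring_scope.

(* Degrees in Z/2 are booleans (false = 0, true = 1), with addition (+), so
   that (-1) ^+ (a && b) is the sign (-1)^(ab).  In characteristic 2 or 3 one
   usually asks for more axioms than these. *)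
HB.mixin Record Lmodule_isLieSuperalg (K : fieldType) L
    of GRing.Lmodule K L := {
  homog : bool -> set L;
  sbr : L -> L -> L;
  homog_submod : forall a, submod_closed (mem (homog a));
  homog_span : forall x : L,
    exists x0 x1, [/\ homog false x0, homog true x1 & x = x0 + x1];
  homog_direct : homog false `&` homog true = [set 0];
  sbr_bilinear : bilinear_for *:%R *:%R sbr;
  homog_sbr : forall a b x y,
    homog a x -> homog b y -> homog (a (+) b) (sbr x y);
  sbr_skew : forall a b x y, homog a x -> homog b y ->
    sbr x y = - ((-1) ^+ (a && b) *: sbr y x);
  sbr_jacobi : forall a b c x y z, homog a x -> homog b y -> homog c z ->
    (-1) ^+ (a && c) *: sbr x (sbr y z) +
    (-1) ^+ (b && a) *: sbr y (sbr z x) +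
    (-1) ^+ (c && b) *: sbr z (sbr x y) = 0
}.

#[short(type="lieSuperalgType")]
HB.structure Definition LieSuperalg (K : fieldType) :=
  {L of Lmodule_isLieSuperalg K L & GRing.Lmodule K L}.

#[short(type="lieSuperVectType")]
HB.structure Definition LieSuperVect (K : fieldType) :=
  {L of LieSuperalg K L & Vector K L}.

Section Dimension.
Variables (K : fieldType) (V : lmodType K).
Implicit Types A B : set V.

Definition lspan A : set V :=
  [set x | exists n (c : 'I_n -> K) (v : 'I_n -> V),
     (forall i, A (v i)) /\ x = \sum_(i < n) c i *: v i].

(* For subspaces B and A: B is contained in A, and A / B has a basis made of
   the cosets of d elements of A.  This determines d, see dim_quot_uniq.  It
   is used instead of \dim because a free Lie superalgebra is in general
   infinite-dimensional. *)
Definition dim_quot A B (d : nat) : Prop :=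
  B `<=` A /\ exists v : 'I_d -> V,
    [/\ forall i, A (v i),
        forall x, A x -> exists c : 'I_d -> K, B (x - \sum_(i < d) c i *: v i)
      & forall c : 'I_d -> K,
          B (\sum_(i < d) c i *: v i) -> forall i, c i = 0].

Definition has_dim A (d : nat) : Prop := dim_quot A [set 0] d.

Lemma dim_quot_le A B d e : submod_closed (mem B) ->
  dim_quot A B d -> dim_quot A B e -> (e <= d)%N.
Proof.
move=> [B0 Blin] [_ [v [_ spanv _]]] [_ [w [Aw _ freew]]].
have BP x : B x <-> x \in mem B by rewrite inE.
have /choice[M MP] j := spanv _ (Aw j).
pose m : 'M[K]_(e, d) := \matrix_(j, i) M j i.
rewrite leqNgt; apply/negP => ltde.
have : kermx m != 0.
  rewrite kermx_eq0 /row_free neq_ltn (leq_ltn_trans (rank_leq_col m)) //.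
case/rowV0Pn => u /sub_kermxP um0 /negP[]; apply/eqP/rowP => j; rewrite mxE.
apply: (freew (fun j => u 0 j)).
have -> : \sum_(k < e) u 0 k *: w k =
    \sum_(k < e) u 0 k *: (w k - \sum_(i < d) M k i *: v i).
  under [RHS]eq_bigr do rewrite scalerBr.
  rewrite sumrB [X in _ - X](_ : _ = 0) ?subr0 //.
  under eq_bigr do rewrite scaler_sumr.
  rewrite exchange_big big1 // => i _.
  under eq_bigr do rewrite scalerA.
  rewrite -scaler_suml.
  have /rowP/(_ i) := um0; rewrite !mxE => um0i.
  rewrite (eq_bigr (fun k => u 0 k * m k i)) ?um0i ?scale0r // => k _.
  by rewrite mxE.
apply/BP; apply: (big_ind (fun x => x \in mem B)) => [//|x y Bx By|k _].
  by rewrite -[x]scale1r; apply: Blin.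
by rewrite -[_ *: _]addr0; apply: Blin => //; apply/BP.
Qed.

Lemma dim_quot_uniq A B d e : submod_closed (mem B) ->
  dim_quot A B d -> dim_quot A B e -> d = e.
Proof.
by move=> B0 Hd He; apply/eqP; rewrite eqn_leq !(@dim_quot_le A B _ _ B0).
Qed.

End Dimension.

Section Subobjects.
Variables (K : fieldType) (L : lieSuperalgType K).
Implicit Types A B I H N : set L.

Definition graded_subspace A : Prop :=
  submod_closed (mem A) /\
  forall x, A x -> exists x0 x1,
    [/\ (A `&` homog false) x0, (A `&` homog true) x1 & x = x0 + x1].

(* dim A = (m|n) *)
Definition has_sdim A (m n : nat) : Prop :=
  has_dim (A `&` homog false) m /\ has_dim (A `&` homog true) n.

Definition commutator A B : set L := lspan [set sbr a b | a in A & b in B].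

Definition graded_ideal I : Prop :=
  graded_subspace I /\ commutator I [set: L] `<=` I.

Definition sub_superalgebra H : Prop :=
  graded_subspace H /\ forall x y, H x -> H y -> H (sbr x y).

Definition has_complement N : Prop :=
  exists H, [/\ sub_superalgebra H,
    forall x, exists u v, [/\ N u, H v & x = u + v]
    & N `&` H = [set 0]].

End Subobjects.

Definition lie_super_hom (K : fieldType) (F G : lieSuperalgType K)
    (f : {linear F -> G}) : Prop :=
  (forall a x, homog a x -> homog a (f x)) /\
  (forall x y, f (sbr x y) = sbr (f x) (f y)).

(* F is free on some Z/2-graded set (X, deg). *)
Definition free_lie_superalg (K : fieldType) (F : lieSuperalgType K) : Prop :=
  exists (X : Type) (deg : X -> bool) (i : X -> F),
    (forall x, homog (deg x) (i x)) /\
    forall (G : lieSuperalgType K) (g : X -> G),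
      (forall x, homog (deg x) (g x)) ->
      exists f : {linear F -> G},
        [/\ lie_super_hom f, forall x, f (i x) = g x
          & forall f' : {linear F -> G},
              lie_super_hom f' -> (forall x, f' (i x) = g x) -> f' =1 f].

Section Multiplier.
Variables (K : fieldType) (F L : lieSuperalgType K) (p : {linear F -> L}).

Definition free_presentation : Prop :=
  [/\ free_lie_superalg F, lie_super_hom p & forall y, exists x, p x = y].

(* M(N,L) = (R n [S,F]) / [R,F], where R is the kernel of p and S the preimage
   of N, has dimension d. *)
Definition multiplier_dim (N : set L) (d : nat) : Prop :=
  let R := p @^-1` [set 0] in
  let S := p @^-1` N in
  dim_quot (R `&` commutator S [set: F]) (commutator R [set: F]) d.

End Multiplier.

(* Main.v *)
Require Import Defs.
From HB Require Import structures.
From mathcomp Require Import all_boot all_order all_algebra.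
From mathcomp Require Import boolp classical_sets.
From mathcomp Require Import zify lra.

(** Let p be the presentation, R its kernel and S the preimage of N.  Since p
    maps [S,F] onto [N,L] with kernel the intersection of R and [S,F], rank-nullity
    gives dim M(N,L) + dim [N,L] = dim [S,F]/[R,F] ([rank_nullity_mod]), and it
    remains to bound dim [S,F]/[R,F].

    Both [R,F] and [S,R] vanish modulo [R,F], so the bracket of F induces a
    bilinear map from N x L to [S,F]/[R,F] whose values span.  Let (s_i) be
    homogeneous lifts of a homogeneous basis of N, and (w_k) lifts of vectors
    of L whose cosets form a basis of L/N.  Then [S,F]/[R,F] is spanned by the
    [s_i,w_k], of which there are dim N dim(L/N), and by the [s_i,s_j]
    ([commutator_preim_span]).  By skew-symmetry the latter are needed only for
    i < j and, when s_i is odd, for i = j: if s_i is even then [s_i,s_i] = 0,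
    as the characteristic is not 2.  With r = m + n this leaves
    r(r-1)/2 + n = ((m+n)^2 + (n-m))/2 brackets ([card_ext2_index]). *)

Set Implicit Arguments.
Unset Strict Implicit.
Unset Printing Implicit Defensive.

Import GRing.Theory.

Local Open Scope classical_set_scope.
Local Open Scope ring_scope.

(** * Subspaces and spans modulo a subspace *)

Section Subspaces.
Variables (K : fieldType) (V : lmodType K).
Implicit Types A B : set V.

Lemma submodP A : submod_closed (mem A) <->
  A 0 /\ forall a x y, A x -> A y -> A (a *: x + y).
Proof.
split=> [[A0 Alin]|[A0 Alin]].
  split=> [|a x y Ax Ay]; first by move: A0; rewrite inE.
  by have := Alin a x y; rewrite !inE; apply.
by split=> [|a x y]; rewrite !inE //; exact: Alin.
Qed.

Lemma submod0 A : submod_closed (mem A) -> A 0.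
Proof. by move=> /submodP[]. Qed.

Lemma submod_lin A a x y : submod_closed (mem A) -> A x -> A y ->
  A (a *: x + y).
Proof. by move=> /submodP[_]; apply. Qed.

Lemma submodD A x y : submod_closed (mem A) -> A x -> A y -> A (x + y).
Proof. by move=> sA Ax Ay; rewrite -[x]scale1r; exact: submod_lin. Qed.

Lemma submodZ A a x : submod_closed (mem A) -> A x -> A (a *: x).
Proof.
by move=> sA Ax; rewrite -[_ *: _]addr0; apply: submod_lin => //; exact: submod0.
Qed.

Lemma submodN A x : submod_closed (mem A) -> A x -> A (- x).
Proof. by move=> sA Ax; rewrite -scaleN1r; exact: submodZ. Qed.

Lemma submodB A x y : submod_closed (mem A) -> A x -> A y -> A (x - y).
Proof. by move=> sA Ax Ay; apply: submodD => //; exact: submodN. Qed.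

Lemma submod_sum A (I : finType) (c : I -> K) (g : I -> V) :
  submod_closed (mem A) -> (forall i, A (g i)) -> A (\sum_i c i *: g i).
Proof.
move=> sA Ag; apply: big_ind => [|x y|i _]; first exact: submod0.
  exact: submodD.
exact: submodZ.
Qed.

Lemma submod_set0 : submod_closed (mem [set 0 : V]).
Proof. by apply/submodP; split=> // a x y -> ->; rewrite scaler0 addr0. Qed.

Lemma submodI A B : submod_closed (mem A) -> submod_closed (mem B) ->
  submod_closed (mem (A `&` B)).
Proof.
move=> sA sB; apply/submodP; split; first by split; exact: submod0.
by move=> a x y [? ?] [? ?]; split; exact: submod_lin.
Qed.

Lemma submod_lspan A : submod_closed (mem (lspan A)).
Proof.
apply/submodP; split.
  by exists 0%N, (fun=> 0), (fun=> 0); split=> [[]//|]; rewrite big_ord0.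
move=> a x y [n [c [v [Av ->]]]] [k [d [w [Aw ->]]]].
exists (n + k)%N,
  (fun i => match split i with inl j => a * c j | inr j => d j end),
  (fun i => match split i with inl j => v j | inr j => w j end); split.
  by move=> i; case: (split i).
rewrite big_split_ord /= scaler_sumr; congr (_ + _); apply: eq_bigr => i _.
  by rewrite (unsplitK (inl i)) scalerA.
by rewrite (unsplitK (inr i)).
Qed.

Lemma lspan_gen A : A `<=` lspan A.
Proof.
move=> x Ax; exists 1%N, (fun=> 1), (fun=> x); split=> //.
by rewrite big_ord1 scale1r.
Qed.

Lemma lspan_sub A B : submod_closed (mem B) -> A `<=` B -> lspan A `<=` B.
Proof.
by move=> sB AB x [n [c [v [Av ->]]]]; apply: submod_sum => // i; exact: AB.
Qed.

(** The sum of B and of the span of a finite family g. *)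
Definition span_mod B (I : finType) (g : I -> V) : set V :=
  [set x | exists c : I -> K, B (x - \sum_i c i *: g i)].

Lemma submod_span_mod B (I : finType) (g : I -> V) :
  submod_closed (mem B) -> submod_closed (mem (span_mod B g)).
Proof.
move=> sB; apply/submodP; split.
  exists (fun=> 0); rewrite big1 ?subr0; first exact: submod0.
  by move=> i _; rewrite scale0r.
move=> a x y [c Bc] [d Bd]; exists (fun i => a * c i + d i).
rewrite (_ : _ - _ = a *: (x - \sum_i c i *: g i) + (y - \sum_i d i *: g i)).
  exact: submod_lin.
rewrite scalerBr addrACA -opprD; congr (_ - _).
rewrite scaler_sumr -big_split; apply: eq_bigr => i _.
by rewrite scalerDl scalerA.
Qed.

Lemma sub_span_mod B (I : finType) (g : I -> V) : B `<=` span_mod B g.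
Proof.
move=> x Bx; exists (fun=> 0); rewrite big1 ?subr0 // => i _.
by rewrite scale0r.
Qed.

Lemma span_mod_gen B (I : finType) (g : I -> V) i :
  submod_closed (mem B) -> span_mod B g (g i).
Proof.
move=> sB; exists (fun j => (j == i)%:R); rewrite (bigD1 i) //= eqxx scale1r.
rewrite big1 => [|j /negPf->]; last by rewrite scale0r.
by rewrite addr0 subrr; exact: submod0.
Qed.

Lemma span_mod_sub A B (I : finType) (g : I -> V) :
  submod_closed (mem A) -> B `<=` A -> (forall i, A (g i)) ->
  span_mod B g `<=` A.
Proof.
move=> sA BA Ag x [c Bc]; rewrite -[x](subrK (\sum_i c i *: g i)).
by apply: submodD => //; [exact: BA | exact: submod_sum].
Qed.

Lemma span_mod_ord B (I : finType) (g : I -> V) :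
  span_mod B g `<=` span_mod B (fun i : 'I_#|I| => g (enum_val i)).
Proof.
move=> x [c Bc]; exists (fun i => c (enum_val i)).
rewrite -(reindex (@enum_val I I) (P := xpredT) (F := fun i => c i *: g i)) //.
exact: onW_bij (@enum_val_bij I).
Qed.

(** A spanning family with the least number of elements is free, hence a
    quotient spanned by finitely many cosets has a dimension. *)
Lemma dim_quot_exists A B (k : nat) (g : 'I_k -> V) :
  submod_closed (mem A) -> submod_closed (mem B) -> B `<=` A ->
  (forall i, A (g i)) -> A `<=` span_mod B g ->
  exists d, dim_quot A B d /\ (d <= k)%N.
Proof.
move=> sA sB BA Ag Aspan.
pose P d := `[< exists v : 'I_d -> V,
  (forall i, A (v i)) /\ A `<=` span_mod B v >].
have exP : exists d, P d by exists k; apply/asboolP; exists g.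
have [d /asboolP[v [Av Aspv]] dmin] := ex_minnP exP.
exists d; split; last by apply: dmin; apply/asboolP; exists g.
split=> //; exists v; split=> // c Bc i; apply: contrapT => /eqP ci0.
case: d v Av Aspv dmin c Bc i ci0 => [|d] v Av Aspv dmin c Bc i ci0.
  by case: i ci0.
suff: P d by move=> /dmin; rewrite ltnn.
apply/asboolP; exists (fun j => v (lift i j)); split=> // x /Aspv.
apply: span_mod_sub => [||j]; [exact: submod_span_mod | exact: sub_span_mod |].
case: (unliftP i j) => [j' ->|->].
  exact: (span_mod_gen (fun j => v (lift i j)) j').
(* The relation Bc is solved for v i. *)
exists (fun j => - ((c i)^-1 * c (lift i j))).
rewrite (_ : _ - _ = (c i)^-1 *: \sum_j c j *: v j); first exact: submodZ.
rewrite (bigD1_ord i) //= scalerDr scalerA mulVf // scale1r -sumrN scaler_sumr.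
by congr (_ + _); apply: eq_bigr => l _; rewrite scaleNr opprK scalerA.
Qed.

End Subspaces.

Section LinearMaps.
Variables (K : fieldType) (V W : lmodType K) (p : {linear V -> W}).

Lemma submod_preim (B : set W) :
  submod_closed (mem B) -> submod_closed (mem (p @^-1` B)).
Proof.
move=> sB; apply/submodP; split=> [|a x y Bx By] /=.
  by rewrite linear0; exact: submod0.
by rewrite linearP; exact: submod_lin.
Qed.

Lemma submod_image (A : set V) :
  submod_closed (mem A) -> submod_closed (mem (p @` A)).
Proof.
move=> sA; apply/submodP; split.
  by exists 0; [exact: submod0 | rewrite linear0].
move=> a _ _ [x Ax <-] [y Ay <-]; exists (a *: x + y); last by rewrite linearP.
exact: submod_lin.
Qed.

Lemma span_mod_preim (B : set W) (I : finType) (v : I -> W) (s : I -> V) :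
  (forall i, p (s i) = v i) ->
  p @^-1` span_mod B v `<=` span_mod (p @^-1` B) s.
Proof.
move=> ps x [c Bc]; exists c => /=; rewrite linearB linear_sum /=.
by under eq_bigr do rewrite linearZ /= ps.
Qed.

End LinearMaps.

Lemma has_dim_vspace (K : fieldType) (W : vectType K) (U : {vspace W}) :
  has_dim [set x | x \in U] (\dim U).
Proof.
split=> [x ->|] /=; first exact: mem0v.
exists (fun i => (vbasis U)`_i); split=> [i|x xU|c Bc i] /=.
- by apply: vbasis_mem; rewrite mem_nth // size_tuple.
- exists (fun i => coord (vbasis U) i x).
  by rewrite -(coord_vbasis xU) subrr.
- by have /freeP := basis_free (vbasisP U); apply.
Qed.

(** Rank-nullity for the map induced on A / B by p, which vanishes on B. *)
Lemma rank_nullity_mod (K : fieldType) (V : lmodType K) (W : vectType K)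
    (p : {linear V -> W}) (A B : set V) (I : finType) (g : I -> V) (e : nat) :
  submod_closed (mem A) -> submod_closed (mem B) ->
  B `<=` p @^-1` [set 0] `&` A ->
  (forall i, A (g i)) -> A `<=` span_mod B g -> has_dim (p @` A) e ->
  exists d, dim_quot (p @^-1` [set 0] `&` A) B d /\ (d + e <= #|I|)%N.
Proof.
move=> sA sB BkA Ag Aspan dime.
pose h i := g (@enum_val I I i).
have Ah i : A (h i) by exact: Ag.
have Aspanh : A `<=` span_mod B h by move=> x /Aspan; exact: span_mod_ord.
pose phi (c : 'rV[K]_#|I|) := \sum_i c 0 i *: h i.
have phi_lin : linear phi.
  move=> a c d; rewrite /phi scaler_sumr -big_split; apply: eq_bigr => i _ /=.
  by rewrite !mxE scalerDl scalerA.
pose phiL := HB.pack phi (GRing.isLinear.Build _ _ _ _ phi phi_lin)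
  : {linear 'rV[K]_#|I| -> V}.
pose f := linfun (p \o phiL : {linear _ -> _}).
have fE c : f c = p (phi c) by rewrite lfunE.
have Aphi c : A (phi c) by exact: submod_sum.
have imgf : [set x | x \in limg f] = p @` A.
  apply/seteqP; split=> [x /= /memv_imgP[c _ ->]|_ [x Ax <-] /=].
    by rewrite fE; exists (phi c).
  have [c Bc] := Aspanh _ Ax; have [/= pc _] := BkA _ Bc.
  apply/memv_imgP; exists (\row_i c i); rewrite ?memvf // fE.
  move/eqP: pc; rewrite linearB subr_eq0 => /eqP->; congr (p _).
  by apply: eq_bigr => i _; rewrite mxE.
have dim_f : (\dim (lker f) + e = #|I|)%N.
  have := has_dim_vspace (limg f); rewrite imgf => dimf.
  have <- := dim_quot_uniq (@submod_set0 _ _) dimf dime.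
  by rewrite -{1}[lker f]capfv limg_ker_dim dimvf /dim /= mul1n.
pose b i := (vbasis (lker f))`_i.
have b_ker (i : 'I_(\dim (lker f))) : b i \in lker f.
  by apply: vbasis_mem; rewrite mem_nth // size_tuple.
have sker : submod_closed (mem (p @^-1` [set 0])).
  by apply: submod_preim; exact: submod_set0.
have kAb (i : 'I_(\dim (lker f))) : (p @^-1` [set 0] `&` A) (phi (b i)).
  by split=> //=; rewrite -fE; apply/eqP; rewrite -memv_ker.
have kAspan : p @^-1` [set 0] `&` A `<=`
    span_mod B (fun i : 'I_(\dim (lker f)) => phi (b i)).
  move=> x [/= px0 Ax].
  have [c Bc] := Aspanh _ Ax; have [/= pc _] := BkA _ Bc.
  have cker : \row_i c i \in lker f.
    rewrite memv_ker fE; apply/eqP.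
    rewrite (_ : phi _ = x - (x - \sum_i c i *: h i)); last first.
      by rewrite subKr; apply: eq_bigr => i _; rewrite mxE.
    by rewrite linearB /= pc px0 subr0.
  exists (fun i => coord (vbasis (lker f)) i (\row_i c i)).
  rewrite (_ : \sum_(i < _) _ = phiL (\row_i c i)).
    rewrite (_ : phiL _ = \sum_i c i *: h i) //.
    by apply: eq_bigr => i _; rewrite mxE.
  rewrite [in RHS](coord_vbasis cker) linear_sum.
  by apply: eq_bigr => i _; rewrite linearZ.
have [d [dimd led]] := dim_quot_exists (submodI sker sA) sB BkA kAb kAspan.
by exists d; split=> //; rewrite -dim_f leq_add2r.
Qed.

(** * Counting the brackets of basis vectors *)

(** The pairs indexing a basis of the super exterior square of a superspace
    with a homogeneous basis of degrees deg: two distinct vectors are taken in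
    one order only, and the square of a vector only if it is odd. *)
Definition ext2_index (I : finType) (deg : I -> bool) : pred (I * I) :=
  [pred ij | (enum_rank ij.1 < enum_rank ij.2)%N
             || (ij.1 == ij.2) && deg ij.1].

Lemma card_ext2_index (I : finType) (deg : I -> bool) :
  (2 * #|ext2_index deg| + #|I| = #|I| ^ 2 + 2 * #|[pred i | deg i]|)%N.
Proof.
pose lt : pred (I * I) := [pred ij | (enum_rank ij.1 < enum_rank ij.2)%N].
pose gt : pred (I * I) := [pred ij | (enum_rank ij.2 < enum_rank ij.1)%N].
pose diag : pred (I * I) := [pred ij | ij.1 == ij.2].
pose odiag : pred (I * I) := [pred ij | (ij.1 == ij.2) && deg ij.1].
have inj_diag (P : pred I) :
    #|[pred ij : I * I | (ij.1 == ij.2) && P ij.1]| = #|P|.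
  have inj_dup : injective (fun i : I => (i, i)) by move=> i j [].
  rewrite -(card_image inj_dup P).
  apply: eq_card => -[i j]; rewrite [LHS]inE /=; apply/idP/idP.
    by move=> /andP[/eqP<- Pi]; apply/fintype.imageP; exists i.
  by move=> /fintype.imageP[l Pl [-> ->]]; rewrite eqxx.
have ltgt : #|lt| = #|gt|.
  have inj_swap : injective (fun ij : I * I => (ij.2, ij.1)).
    by move=> [a b] [c d] [-> ->].
  rewrite -(card_image inj_swap lt).
  apply: eq_card => -[i j]; rewrite [RHS]inE /=; apply/idP/idP.
    by move=> /fintype.imageP[[a b]] /= + [-> ->].
  by move=> ji; apply/fintype.imageP; exists (j, i).
have dE : #|diag| = #|I|.
  rewrite -(inj_diag predT); apply: eq_card => -[i j].
  by rewrite !inE /= andbT.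
have oE : #|odiag| = #|[pred i | deg i]| by exact: inj_diag.
have ext : #|ext2_index deg| = (#|lt| + #|odiag|)%N.
  rewrite -[RHS]cardUI [X in (_ + X)%N]eq_card0 ?addn0.
    by apply: eq_card => -[i j]; rewrite !inE.
  by move=> [i j]; rewrite !inE /=; case: eqP => [->|]; rewrite ?ltnn ?andbF.
have all2 : (#|lt| + #|gt| + #|diag| = #|I| ^ 2)%N.
  have -> : (#|I| ^ 2 = #|{: I * I}|)%N by rewrite card_prod mulnn.
  rewrite -(cardC lt) -addnA; congr (_ + _)%N.
  rewrite -cardUI [X in (_ + X)%N]eq_card0 ?addn0.
    apply: eq_card => -[i j]; rewrite !inE /= -leqNgt orbC [RHS]leq_eqVlt.
    by congr orb; rewrite (inj_eq val_inj) (inj_eq enum_rank_inj) eq_sym.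
  by move=> [i j]; rewrite !inE /=; case: eqP => [->|]; rewrite ?ltnn ?andbF.
lia.
Qed.

(** * Brackets modulo [R,F] *)

Section Superalgebra.
Variables (K : fieldType) (F : lieSuperalgType K).
Implicit Types A B C R : set F.

Lemma sbr_linl (z : F) a x y : sbr (a *: x + y) z = a *: sbr x z + sbr y z.
Proof. by have [lin _] := @sbr_bilinear K F; exact: lin. Qed.

Lemma sbr_linr (z : F) a x y : sbr z (a *: x + y) = a *: sbr z x + sbr z y.
Proof. by have [_ lin] := @sbr_bilinear K F; exact: lin. Qed.

Lemma sbr0l (z : F) : sbr 0 z = 0.
Proof. by have := sbr_linl z (-1) 0 0; rewrite scaler0 addr0 scaleN1r addNr. Qed.

Lemma sbr0r (z : F) : sbr z 0 = 0.
Proof. by have := sbr_linr z (-1) 0 0; rewrite scaler0 addr0 scaleN1r addNr. Qed.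

Lemma submod_sbrl B (z : F) :
  submod_closed (mem B) -> submod_closed (mem [set x | B (sbr x z)]).
Proof.
move=> sB; apply/submodP; split=> [|a x y] /=.
  by rewrite sbr0l; exact: submod0.
by rewrite sbr_linl; exact: submod_lin.
Qed.

Lemma submod_sbrr B (z : F) :
  submod_closed (mem B) -> submod_closed (mem [set x | B (sbr z x)]).
Proof.
move=> sB; apply/submodP; split=> [|a x y] /=.
  by rewrite sbr0r; exact: submod0.
by rewrite sbr_linr; exact: submod_lin.
Qed.

Lemma submod_commutator A B : submod_closed (mem (commutator A B)).
Proof. exact: submod_lspan. Qed.

Lemma sbr_commutator A B x y : A x -> B y -> commutator A B (sbr x y).
Proof. by move=> Ax By; apply: lspan_gen; exists x => //; exists y. Qed.

Lemma commutator_sub A B C : submod_closed (mem C) ->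
  (forall x y, A x -> B y -> C (sbr x y)) -> commutator A B `<=` C.
Proof.
by move=> sC ABC; apply: lspan_sub => // _ [x Ax [y By <-]]; exact: ABC.
Qed.

Lemma sbr_commutatorC R x r : graded_subspace R -> R r ->
  commutator R [set: F] (sbr x r).
Proof.
move=> [sR grR] Rr; have sC := submod_commutator R setT.
have [x0 [x1 [hx0 hx1 ->]]] := homog_span x.
have swap a b y z : homog a y -> (R `&` homog b) z ->
    commutator R [set: F] (sbr y z).
  move=> hy [Rz hz]; rewrite (sbr_skew _ _ _ _ hy hz).
  by apply: submodN => //; apply: submodZ => //; exact: sbr_commutator.
have [r0 [r1 [Rr0 Rr1 ->]]] := grR _ Rr.
rewrite -[x0]scale1r -[r0]scale1r sbr_linl !sbr_linr !scale1r.
apply: (submodD sC); apply: (submodD sC).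
- exact: (swap _ _ _ _ hx0 Rr0).
- exact: (swap _ _ _ _ hx0 Rr1).
- exact: (swap _ _ _ _ hx1 Rr0).
- exact: (swap _ _ _ _ hx1 Rr1).
Qed.

Lemma sbr_even_self (char2 : 2%N \notin [pchar K]) (x : F) :
  homog false x -> sbr x x = 0.
Proof.
move=> hx; have := sbr_skew _ _ _ _ hx hx; rewrite expr0 scale1r => /eqP.
rewrite -addr_eq0 -mulr2n -scaler_nat scaler_eq0 => /orP[|/eqP//] two0.
by move: char2; rewrite inE /= two0.
Qed.

(** If A lies in R + <s_i> and F = A + <w_k>, then modulo [R,F] every element of
    [A,F] is a combination of the [s_i,w_k] and the [s_i,s_j] with (i,j) in
    [ext2_index deg]. *)
Lemma commutator_span (char2 : 2%N \notin [pchar K]) R A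
    (I J : finType) (deg : I -> bool) (s : I -> F) (w : J -> F) :
  graded_subspace R -> (forall i, homog (deg i) (s i)) ->
  A `<=` span_mod R s -> [set: F] `<=` span_mod A w ->
  commutator A [set: F] `<=`
  span_mod (commutator R [set: F])
    (fun t : {ij | ext2_index deg ij} + I * J =>
       match t with
       | inl u => sbr (s (val u).1) (s (val u).2)
       | inr ik => sbr (s ik.1) (w ik.2)
       end).
Proof.
move=> grR hs As Fw; set g := fun t => _; set E := span_mod _ _.
have sC := submod_commutator R [set: F].
have sE : submod_closed (mem E) by exact: submod_span_mod.
have CE : commutator R [set: F] `<=` E by exact: sub_span_mod.
have Ess_index i j : ext2_index deg (i, j) -> E (sbr (s i) (s j)).
  by move=> ij; exact: (span_mod_gen g (inl (exist _ (i, j) ij)) sC).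
have Ess i j : E (sbr (s i) (s j)).
  have [ij|ji|/val_inj/enum_rank_inj <-] :=
    ltngtP (enum_rank i) (enum_rank j).
  - by apply: Ess_index; rewrite /ext2_index /= ij.
  - rewrite (sbr_skew _ _ _ _ (hs i) (hs j)); apply: submodN => //.
    by apply: submodZ => //; apply: Ess_index; rewrite /ext2_index /= ji.
  - have [odd_i|even_i] := boolP (deg i).
      by apply: Ess_index; rewrite /ext2_index /= eqxx odd_i orbT.
    rewrite sbr_even_self //; first exact: submod0.
    by rewrite -(negbTE even_i).
have Esx i x : A x -> E (sbr (s i) x).
  move=> /As.
  apply: (span_mod_sub (A := [set x | E (sbr (s i) x)])) => [|r Rr|j] /=.
  - exact: submod_sbrr.
  - by apply: CE; exact: sbr_commutatorC.
  - exact: Ess.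
have Esf i f : E (sbr (s i) f).
  have /Fw : [set: F] f by [].
  apply: (span_mod_sub (A := [set x | E (sbr (s i) x)])) => [|x Ax|k] /=.
  - exact: submod_sbrr.
  - exact: Esx.
  - exact: (span_mod_gen g (inr (i, k)) sC).
apply: commutator_sub => // x f /As Rsx _.
apply: (span_mod_sub (A := [set x | E (sbr x f)]) _ _ _ Rsx) => [|r Rr|i] /=.
- exact: submod_sbrl.
- by apply: CE; exact: sbr_commutator.
- exact: Esf.
Qed.

End Superalgebra.

(** * Homomorphisms *)

Section Homomorphism.
Variables (K : fieldType) (F L : lieSuperalgType K) (p : {linear F -> L}).
Hypotheses (hom_p : lie_super_hom p) (surj_p : forall y, exists x, p x = y).

Lemma homog_both0 (x : L) a : homog a x -> homog (~~ a) x -> x = 0.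
Proof.
have both0 y : homog false y -> homog true y -> y = 0 :> L.
  move=> y0 y1; have : (homog false `&` homog true) y by [].
  by rewrite homog_direct.
by case: a => h h'; apply: both0.
Qed.

Lemma graded_ker : graded_subspace (p @^-1` [set 0]).
Proof.
split; first by apply: submod_preim; exact: submod_set0.
move=> x /= px0; have [x0 [x1 [h0 h1 xE]]] := homog_span x.
have px01 : p x0 = - p x1.
  by apply/eqP; rewrite -addr_eq0 -linearD -xE px0.
have p0 : p x0 = 0.
  apply: (homog_both0 (hom_p.1 _ _ h0)); rewrite px01.
  by apply: submodN; [exact: homog_submod | exact: hom_p.1].
exists x0, x1; split=> //; split=> //=.
by apply/eqP; rewrite -oppr_eq0 -px01 p0.
Qed.

Lemma homog_lift a y : homog a y -> exists x, homog a x /\ p x = y.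
Proof.
move=> hy; have [x pxy] := surj_p y.
have [x0 [x1 [h0 h1 xE]]] := homog_span x.
have pE : y = p x0 + p x1 by rewrite -pxy xE linearD.
have hp0 := hom_p.1 _ _ h0; have hp1 := hom_p.1 _ _ h1.
case: a hy => hy.
  exists x1; split=> //; rewrite pE (_ : p x0 = 0) ?add0r //.
  apply: (homog_both0 hp0) => /=.
  rewrite (_ : p x0 = y - p x1); last by rewrite pE addrK.
  by apply: submodB => //; exact: homog_submod.
exists x0; split=> //; rewrite pE (_ : p x1 = 0) ?addr0 //.
apply: (homog_both0 hp1) => /=.
rewrite (_ : p x1 = y - p x0); last by rewrite pE addrC addKr.
by apply: submodB => //; exact: homog_submod.
Qed.

Lemma image_commutator_preim (N : set L) :
  p @` commutator (p @^-1` N) [set: F] = commutator N [set: L].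
Proof.
apply/seteqP; split.
  move=> _ [x Cx <-].
  apply: (@commutator_sub _ _ _ _ (p @^-1` commutator N setT) _ _ x Cx).
    by apply: submod_preim; exact: submod_commutator.
  by move=> u v /= Nu _; rewrite hom_p.2; exact: sbr_commutator.
apply: commutator_sub.
  by apply: submod_image; exact: submod_commutator.
move=> u v Nu _; have [x px] := surj_p u; have [y py] := surj_p v.
exists (sbr x y); last by rewrite hom_p.2 px py.
by apply: sbr_commutator => //=; rewrite px.
Qed.

Lemma commutator_ker_sub (N : set L) : N 0 ->
  commutator (p @^-1` [set 0]) [set: F] `<=`
  p @^-1` [set 0] `&` commutator (p @^-1` N) [set: F].
Proof.
move=> N0; apply: commutator_sub.
  apply: submodI; last exact: submod_commutator.
  by apply: submod_preim; exact: submod_set0.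
move=> x y /= px _; split=> /=; first by rewrite hom_p.2 px sbr0l.
by apply: sbr_commutator => //=; rewrite px.
Qed.

(** The family of [commutator_span], for the preimage of N and lifts of bases of
    N and L/N: its size is that of the super exterior square of N plus
    dim N dim(L/N). *)
Lemma commutator_preim_span (char2 : 2%N \notin [pchar K]) (N : set L)
    (m n q : nat) :
  graded_ideal N -> has_sdim N m n -> dim_quot [set: L] N q ->
  exists (T : finType) (g : T -> F),
    [/\ (2 * #|T| + (m + n) = (m + n) ^ 2 + 2 * n + 2 * ((m + n) * q))%N,
        forall t, commutator (p @^-1` N) [set: F] (g t)
      & commutator (p @^-1` N) [set: F] `<=`
          span_mod (commutator (p @^-1` [set 0]) [set: F]) g].
Proof.
move=> [[sN grN] _] [[_ [v0 [Nv0 spv0 _]]] [_ [v1 [Nv1 spv1 _]]]].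
move=> [_ [u [_ spu _]]].
pose deg (i : 'I_m + 'I_n) := if i is inr _ then true else false.
pose v (i : 'I_m + 'I_n) := match i with inl i => v0 i | inr i => v1 i end.
have lift_v i : exists x, homog (deg i) x /\ p x = v i.
  by apply: homog_lift; case: i => i; [have [] := Nv0 i | have [] := Nv1 i].
have [s sP] := choice lift_v.
have [w wP] := choice (fun k => surj_p (u k)).
have Nv i : N (v i) by case: i => i; [have [] := Nv0 i | have [] := Nv1 i].
have Ss : p @^-1` N `<=` span_mod (p @^-1` [set 0]) s.
  move=> x /= Nx; apply: (span_mod_preim (v := v)) => /= [i|].
    by have [] := sP i.
  have [x0 [x1 [N0 N1 ->]]] := grN _ Nx.
  have [c0 /= c0P] := spv0 _ N0; have [c1 /= c1P] := spv1 _ N1.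
  exists (fun i => match i with inl i => c0 i | inr i => c1 i end) => /=.
  by rewrite big_sumType /= opprD addrACA c0P c1P addr0.
have Fw : [set: F] `<=` span_mod (p @^-1` N) w.
  by move=> x _; apply: (span_mod_preim wP); exact: spu.
have hs i : homog (deg i) (s i) by have [] := sP i.
have := commutator_span char2 graded_ker hs Ss Fw.
set g := fun t => _ => Cg; exists _, g; split=> // [|t].
  have := card_ext2_index deg.
  have -> : #|[pred i | deg i]| = n.
    rewrite -sum1_card big_sumType /= big_pred0 //= add0n.
    by rewrite sum1_card card_ord.
  have card_pairs : #|{: {ij | ext2_index deg ij}}| = #|ext2_index deg|.
    by rewrite card_sig; apply: eq_card.
  rewrite !card_sum card_pairs card_prod card_sum !card_ord; lia.
case: t => [[[i j] ij]|[i k]]; apply: sbr_commutator => //=;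
  by have [_ ->] := sP i.
Qed.

End Homomorphism.

Theorem corollary3p3 (K : closedFieldType)
    (char2 : 2%N \notin [pchar K]) (char3 : 3%N \notin [pchar K])
    (L : lieSuperVectType K) (N : set L) (idealN : graded_ideal N)
    (complN : has_complement N)
    (m n : nat) (dimN : has_sdim N m n)
    (q : nat) (dimLN : dim_quot [set: L] N q)
    (e : nat) (dim_NL : has_dim (commutator N [set: L]) e)
    (F : lieSuperalgType K) (p : {linear F -> L})
    (presL : free_presentation p) :
  exists d : nat, multiplier_dim p N d /\
    (d%:R <= 1 / 2 * ((m + n)%:R ^+ 2 + (n%:R - m%:R))
             + (m + n)%:R * q%:R - e%:R :> rat).
Proof.
have [_ hom_p surj_p] := presL.
have [T [g [cardT Sg spang]]] :=
  commutator_preim_span hom_p surj_p char2 idealN dimN dimLN.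
have N0 : N 0 by apply: submod0; case: idealN => -[].
rewrite -(image_commutator_preim hom_p surj_p) in dim_NL.
have [d [dimM le_d]] := rank_nullity_mod (submod_commutator _ _)
  (submod_commutator _ _) (commutator_ker_sub hom_p N0) Sg spang dim_NL.
exists d; split=> //.
have : (2 * (d + e) + (m + n) <= (m + n) ^ 2 + 2 * n + 2 * ((m + n) * q))%N.
  by rewrite -cardT leq_add2r leq_mul2l.
rewrite -(Num.Theory.ler_nat rat) !(natrD, natrM, natrX); lra.
Qed.
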